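(* Let $\mathbb{F}=\mathbb{R}$ or $\mathbb{F}=\mathbb{C}$, let $m\geq n\geq 1$ be integers, and let $X,Y\in M_{m\times n}(\mathbb{F})$ with $X\neq 0$. There is a positive semidefinite $A\in M_{m}(\mathbb{F})$ such that $AX=Y$ if and only if $X^*Y\geq 0$ and $\operatorname{null} Y=\operatorname{null}(X^*Y)$.
   Context: $M_{m\times n}(\mathbb{F})$ is the set of $m\times n$ matrices over $\mathbb{F}$ and $M_m(\mathbb{F})=M_{m\times m}(\mathbb{F})$. $\operatorname{null} Z$ denotes the null space of $Z$, and $Z^*$ its conjugate transpose (the transpose if $\mathbb{F}=\mathbb{R}$). A matrix $A\in M_k(\mathbb{F})$ is positive semidefinite, written $A\geq 0$, if $A$ is Hermitian ($A=A^*$) and $\mathbf{u}^*A\mathbf{u}\geq 0$ for all nonzero $\mathbf{u}\in\mathbb{F}^k$. *)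

(* Defs.v *)
From HB Require Import structures.
From mathcomp Require Import all_boot all_order all_algebra.
From mathcomp Require Import reals.
From mathcomp Require Import complex.

Set Implicit Arguments.
Unset Strict Implicit.
Unset Printing Implicit Defensive.

Import Order.TTheory GRing.Theory Num.Theory.
Local Open Scope ring_scope.

Variant scalar_kind := RealScalars | ComplexScalars.

(* In the order of the numFieldType R[i], 0 <= z means that z is real and
   nonnegative. *)
Definition scalars (R : realType) (k : scalar_kind) : numFieldType :=
  match k with
  | RealScalars => R : numFieldType
  | ComplexScalars => R[i] : numFieldType
  end.

Definition scalar_conj (R : realType) (k : scalar_kind) :
    scalars R k -> scalars R k :=
  match k return scalars R k -> scalars R k with
  | RealScalars => fun x => x
  | ComplexScalars => fun z : R[i] => Num.conj z
  end.

Section Matrices.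
Variables (R : realType) (k : scalar_kind).
Local Notation F := (scalars R k).

Definition adjmx (m n : nat) (Z : 'M[F]_(m, n)) : 'M[F]_(n, m) :=
  map_mx (@scalar_conj R k) Z^T.

Definition psdmx (n : nat) (A : 'M[F]_n) : Prop :=
  A = adjmx A /\
  forall u : 'cV[F]_n, u != 0 -> 0 <= (adjmx u *m A *m u) 0 0.

(* The null space acts on column vectors, unlike the row kernel [kermx]. *)
Definition nullspace (m n : nat) (Z : 'M[F]_(m, n)) : {vspace 'cV[F]_n} :=
  lker (linfun (mulmx Z : 'cV[F]_n -> 'cV[F]_m)).

End Matrices.

(* Main.v *)
(** If [A X = Y] with [A] positive semidefinite, then [X^* Y = X^* A X] is positive semidefinite, and [X^* Y v = 0] makes the form of [A] vanish at [X v], which forces [A X v = Y v = 0].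
    Conversely, let [G] be any generalized inverse of [S = X^* Y], that is [S G S = S].  Then [A = (Y G) S (Y G)^*] is positive semidefinite by congruence.  Since [null S] is contained in [null Y], the identity [S (G S - 1) = 0] gives [Y G S = Y], hence [A X = Y G S G^* S = Y G (S G S)^* = Y G S = Y]. *)
Require Import Defs.
From HB Require Import structures.
From mathcomp Require Import all_boot all_order all_algebra.
From mathcomp Require Import reals complex ring.
Local Open Scope ring_scope.
Import Order.TTheory GRing.Theory Num.Theory.

Section ScalarConj.
Context {R : realType} {k : scalar_kind}.
Local Notation F := (scalars R k).
Local Notation conj := (@scalar_conj R k).

Lemma scalar_conj_is_zmod_morphism : zmod_morphism conj.
Proof. by case: k => // x y; exact: rmorphB. Qed.

Lemma scalar_conj_is_monoid_morphism : monoid_morphism conj.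
Proof. by case: k; split=> //; [exact: rmorph1 | exact: rmorphM]. Qed.

(** With [scalar_conj] a ring morphism, the [map_mx] lemmas give the algebra of [adjmx] over both
    scalar fields at once. *)
HB.instance Definition _ :=
  GRing.isZmodMorphism.Build F F conj scalar_conj_is_zmod_morphism.
HB.instance Definition _ :=
  GRing.isMonoidMorphism.Build F F conj scalar_conj_is_monoid_morphism.

Lemma scalar_conjK : involutive conj.
Proof. by case: k => // x; exact: conjCK. Qed.

Lemma scalar_conj_ge0 (x : F) : 0 <= x -> conj x = x.
Proof. by move: x; case: k => // x /geC0_conj. Qed.

Lemma mul_scalar_conj (x : F) : conj x * x = `|x| ^+ 2.
Proof.
move: x; case: k => x /=; first by rewrite -expr2 real_normK ?num_real.
by rewrite mulrC normCK.
Qed.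

End ScalarConj.

Section Adjoint.
Context {R : realType} {k : scalar_kind}.
Local Notation F := (scalars R k).

Lemma adjmxM m n p (A : 'M[F]_(m, n)) (B : 'M[F]_(n, p)) :
  adjmx (A *m B) = adjmx B *m adjmx A.
Proof. by rewrite /adjmx trmx_mul map_mxM. Qed.

Lemma adjmxB m n (A B : 'M[F]_(m, n)) : adjmx (A - B) = adjmx A - adjmx B.
Proof. by rewrite /adjmx linearB /= map_mxB. Qed.

Lemma adjmxZ m n c (A : 'M[F]_(m, n)) :
  adjmx (c *: A) = scalar_conj c *: adjmx A.
Proof. by rewrite /adjmx linearZ /= map_mxZ. Qed.

Lemma adjmxK m n (A : 'M[F]_(m, n)) : adjmx (adjmx A) = A.
Proof. by apply/matrixP=> i j; rewrite !mxE scalar_conjK. Qed.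

Lemma adjmx_mul_self m (v : 'cV[F]_m) :
  (adjmx v *m v) 0 0 = \sum_i `|v i 0| ^+ 2.
Proof.
by rewrite mxE; apply: eq_bigr => i _; rewrite !mxE mul_scalar_conj.
Qed.

Lemma adjmx_mul_self_ge0 m (v : 'cV[F]_m) : 0 <= (adjmx v *m v) 0 0.
Proof. by rewrite adjmx_mul_self sumr_ge0 // => i _; rewrite exprn_ge0. Qed.

Lemma adjmx_mul_self_eq0 m (v : 'cV[F]_m) : (adjmx v *m v) 0 0 = 0 -> v = 0.
Proof.
rewrite adjmx_mul_self => /eqP.
rewrite psumr_eq0 => [/allP v0|i _]; last exact: exprn_ge0.
apply/colP=> i; rewrite mxE; apply/eqP.
by have := v0 i (mem_index_enum i); rewrite sqrf_eq0 normr_eq0.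
Qed.

(** [psdmx] tests nonzero vectors only; at 0 the form vanishes, so the case split is made once,
    here. *)
Lemma psdmx_ge0 m (A : 'M[F]_m) (u : 'cV[F]_m) :
  psdmx A -> 0 <= (adjmx u *m A *m u) 0 0.
Proof.
case=> _ Age0; have [->|/Age0//] := eqVneq u 0.
by rewrite mulmx0 mxE.
Qed.

Lemma psdmx_congr m n (A : 'M[F]_m) (B : 'M[F]_(m, n)) :
  psdmx A -> psdmx (adjmx B *m A *m B).
Proof.
move=> psdA; split=> [|u _].
  by rewrite !adjmxM adjmxK -psdA.1 mulmxA.
by have := psdmx_ge0 _ _ (B *m u) psdA; rewrite adjmxM !mulmxA.
Qed.

(* With [v = A w], [a = v^* v] and [b = v^* A v], the form of [A] takes the
   value [- a^2 (b + 2)] at [(b + 1) w - a v]; hence [a = 0]. *)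
Lemma psdmx_form_eq0 m (A : 'M[F]_m) (w : 'cV[F]_m) :
  psdmx A -> (adjmx w *m A *m w) 0 0 = 0 -> A *m w = 0.
Proof.
move=> psdA w0; set v := A *m w.
have adjv : adjmx w *m A = adjmx v by rewrite adjmxM -psdA.1.
set a := (adjmx v *m v) 0 0; set b := (adjmx v *m A *m v) 0 0.
have a0 : 0 <= a by exact: adjmx_mul_self_ge0.
have b0 : 0 <= b by exact: psdmx_ge0.
have := psdmx_ge0 _ _ ((b + 1) *: w - a *: v) psdA.
have -> : (adjmx ((b + 1) *: w - a *: v) *m A *m
           ((b + 1) *: w - a *: v)) 0 0 = - (a ^+ 2 * (b + 2)).
  rewrite adjmxB !adjmxZ !scalar_conj_ge0 ?addr_ge0 //.
  rewrite !mulmxBl !mulmxBr -!scalemxAl -!scalemxAr adjv.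
  rewrite -(mulmxA (adjmx v) A w) -/v.
  (* Rewriting with [adjv] has turned the term [w^* A w] into [v^* w], so [w0] applies to it in this
     shape. *)
  have vw0 : (adjmx v *m w) 0 0 = 0 by rewrite -adjv.
  rewrite !mxE in vw0 *; move: vw0 => ->.
  rewrite /a /b !mxE; ring.
rewrite oppr_ge0 => le0; apply: adjmx_mul_self_eq0; rewrite -/a.
have b2 : 0 < b + 2 by rewrite ltr_wpDl.
(* The order on [R[i]] is partial; [a] is real because it is nonnegative, so [a ^+ 2 <= 0] forces
   [a = 0]. *)
by move: le0; rewrite pmulr_lle0 // real_exprn_even_le0 ?ger0_real //= => /eqP.
Qed.

Lemma mem_nullspace m n (Z : 'M[F]_(m, n)) (v : 'cV[F]_n) :
  (v \in nullspace Z) = (Z *m v == 0).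
Proof. by rewrite memv_ker lfunE. Qed.

(** The inclusion is applied to [B] one column at a time. *)
Lemma nullspace_sub_mulmx m n p q (Y : 'M[F]_(m, n)) (S : 'M[F]_(p, n))
    (B : 'M[F]_(n, q)) :
  (nullspace S <= nullspace Y)%VS -> S *m B = 0 -> Y *m B = 0.
Proof.
move=> /subvP sub SB0; apply/matrixP => i j.
have: col j B \in nullspace Y.
  by rewrite sub // mem_nullspace colE mulmxA SB0 mul0mx.
by rewrite mem_nullspace colE mulmxA -colE => /eqP/colP/(_ i); rewrite !mxE.
Qed.

End Adjoint.

Theorem theorem5p1 (R : realType) (k : scalar_kind) (m n : nat)
    (hn : (1 <= n)%N) (hmn : (n <= m)%N)
    (X Y : 'M[scalars R k]_(m, n)) (hX : X != 0) :
  (exists A : 'M[scalars R k]_m, psdmx A /\ A *m X = Y) <->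
  (psdmx (adjmx X *m Y) /\ nullspace Y = nullspace (adjmx X *m Y)).
Proof.
split=> [[A [psdA <-]]|[psdS eqN]].
  split; first by rewrite mulmxA; exact: psdmx_congr.
  apply/vspaceP => v; rewrite !mem_nullspace -!mulmxA.
  apply/eqP/eqP => [->|XAXv]; first by rewrite mulmx0.
  apply: psdmx_form_eq0 => //.
  by rewrite adjmxM -!mulmxA XAXv mulmx0 mxE.
set S := adjmx X *m Y in psdS eqN *.
have YX : adjmx Y *m X = S by rewrite psdS.1 adjmxM adjmxK.
clearbody S.
(* [S] lies in its own row space, on which [pinvmx S] acts as an inverse. *)
have [G SGS] : exists G, S *m G *m S = S by exists (pinvmx S); rewrite mulmxKpV.
have YGS : Y *m G *m S = Y.
  apply/eqP; rewrite -subr_eq0 -mulmxA -{2}(mulmx1 Y) -mulmxBr; apply/eqP.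
  apply: (@nullspace_sub_mulmx _ _ _ _ _ _ _ S); first by rewrite eqN.
  by rewrite mulmxBr mulmxA SGS mulmx1 subrr.
(* As [S] is Hermitian, taking adjoints in [SGS] shows that [adjmx G] is a generalized inverse
   too. *)
have SGS' : S *m adjmx G *m S = S.
  by move: (congr1 (@adjmx _ _ _ _) SGS); rewrite !adjmxM -psdS.1 mulmxA.
exists (Y *m G *m S *m adjmx (Y *m G)); split.
  (* Congruence has the shape [B^* S B], hence the choice [B = (Y G)^*]. *)
  by have := psdmx_congr _ _ _ (adjmx (Y *m G)) psdS; rewrite adjmxK.
by rewrite adjmxM -!mulmxA YX (mulmxA S) SGS' mulmxA.
Qed.
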